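(* Let $n\ge 1$ and let $G\subsetneq\mathbb{R}^n$ be a domain. Then the point pair function $p_G$ is a quasi-metric on $G$ with a constant less than or equal to $\sqrt{5}/2$; that is, $p_G$ is positive (with $p_G(x,y)=0$ if and only if $x=y$), symmetric, and there is a constant $c$ with $1\le c\le \sqrt5/2$ such that $$p_G(x,y)\le c\,\bigl(p_G(x,z)+p_G(z,y)\bigr)\quad\text{for all }x,y,z\in G.$$
   Context: A domain is a nonempty open connected set. For a domain $G\subsetneq\mathbb{R}^n$ and $x\in G$, $d_G(x)=\inf\{|x-z| : z\in\partial G\}$ denotes the Euclidean distance from $x$ to the boundary $\partial G$. The point pair function $p_G:G\times G\to[0,1)$ is $$p_G(x,y)=\frac{|x-y|}{\sqrt{|x-y|^2+4d_G(x)d_G(y)}},\quad x,y\in G.$$ A function $d:G\times G\to[0,\infty)$ is a quasi-metric with constant $c\ge1$ if (1) $d(x,y)\ge0$, with $d(x,y)=0$ if and only if $x=y$; (2) $d(x,y)=d(y,x)$; and (3) $d(x,y)\le c(d(x,z)+d(z,y))$ for all $x,y,z\in G$, where $c$ is independent of $x,y,z$. *)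

(* Defs.v *)
From HB Require Import structures.
From mathcomp Require Import all_boot all_order all_algebra.
From mathcomp Require Import all_classical all_reals all_analysis.

Set Implicit Arguments.
Unset Strict Implicit.
Unset Printing Implicit Defensive.

Import Order.TTheory GRing.Theory Num.Theory.
Import numFieldNormedType.Exports.

Local Open Scope classical_set_scope.
Local Open Scope ring_scope.

Definition domain (T : topologicalType) (G : set T) : Prop :=
  [/\ G !=set0, open G & connected G].

Definition boundary (T : topologicalType) (G : set T) : set T :=
  closure G `\` interior G.

(* The norm `|x| that the library puts on 'rV[R]_n is the max norm; it induces
   the usual topology of R^n, but the distances below must be Euclidean. *)
Definition enorm (R : realType) (n : nat) (x : 'rV[R]_n) : R :=
  Num.sqrt (\sum_(i < n) x ord0 i ^+ 2).

(* Total functions of x and y, meaningful for x, y in a domain G other than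
   the whole space: the infimum is then over a nonempty set bounded below. *)
Definition bdist (R : realType) (n : nat) (G : set 'rV[R]_n) (x : 'rV[R]_n) : R :=
  inf [set enorm (x - z) | z in boundary G].

Definition point_pair (R : realType) (n : nat) (G : set 'rV[R]_n)
    (x y : 'rV[R]_n) : R :=
  enorm (x - y) / Num.sqrt (enorm (x - y) ^+ 2 + 4 * bdist G x * bdist G y).

Definition quasi_metric (R : realType) (T : Type) (G : set T) (c : R)
    (d : T -> T -> R) : Prop :=
  [/\ 1 <= c,
      forall x y, G x -> G y -> 0 <= d x y /\ (d x y = 0 <-> x = y),
      forall x y, G x -> G y -> d x y = d y x
    & forall x y z, G x -> G y -> G z -> d x y <= c * (d x z + d z y)].

(* Main.v *)
(** Write [u = |x - z|], [v = |z - y|], [t = |x - y|], let [a], [b], [c] be the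
    boundary distances of [x], [y], [z], and put [p = p_G(x, z)],
    [q = p_G(z, y)].  With [S = sqrt (u^2 + 4ac)] and [W = sqrt (v^2 + 4bc)] we
    have [u = pS] and [v = qW].  As the boundary distance is 1-Lipschitz,
    [c <= a + u], which amounts to [2c <= S (1 + p)]; likewise
    [2c <= W (1 + q)].  Hence [2c t <= 2c (pS + qW) <= S W (p + q + 2pq)], and
    since [4ac = S^2 (1 - p^2)] and [4bc = W^2 (1 - q^2)] this gives
    [t^2 (1 - p^2)(1 - q^2) <= 4ab (p + q + 2pq)^2].  It remains to compare
    [p + q + 2pq] with [p + q], a polynomial inequality in [p] and [q] that is
    sharp at [p = q = 1/5]. *)
Require Import Defs.
From mathcomp Require Import all_boot all_order all_algebra.
From mathcomp Require Import all_classical all_reals all_analysis.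
From mathcomp Require Import ring lra.
Import Order.TTheory GRing.Theory Num.Theory.
Import numFieldNormedType.Exports.
Local Open Scope classical_set_scope.
Local Open Scope ring_scope.

(** The difference of the two sides is a square plus a nonnegative multiple of [(p - q) ^+ 2]. Both
    terms vanish at [p = q = 1/5], which is where the constant [Num.sqrt 5 / 2] comes from. *)
Lemma pair_sum_ineq (R : realFieldType) (p q : R) : 0 <= p -> 0 <= q ->
  4 * (p + q + 2 * p * q) ^+ 2 <=
  5 * (p + q) ^+ 2 *
    ((p + q + 2 * p * q) ^+ 2 + (1 - p ^+ 2) * (1 - q ^+ 2)).
Proof.
move=> p0 q0; rewrite -subr_ge0.
set s := p + q; set m := p * q.
have -> : 5 * s ^+ 2 * ((s + 2 * p * q) ^+ 2 + (1 - p ^+ 2) * (1 - q ^+ 2)) -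
    4 * (s + 2 * p * q) ^+ 2 =
  (5 * m * s + 8 * m - s) ^+ 2 + 20 * m * (p - q) ^+ 2 * (1 + s).
  by rewrite /s /m; ring.
have m0 : 0 <= m by exact: mulr_ge0.
have s0 : 0 <= 1 + s by rewrite /s; lra.
by rewrite addr_ge0 ?sqr_ge0// mulr_ge0// mulr_ge0 ?sqr_ge0// mulr_ge0.
Qed.

(** Since [c - u <= a], [(2c - u)^2 = u^2 + 4c(c - u)] is at most [u^2 + 4ac]. *)
Lemma double_le_addr_sqrt (R : rcfType) (a c u : R) : 0 <= c -> c <= a + u ->
  2 * c <= Num.sqrt (u ^+ 2 + 4 * a * c) + u.
Proof.
move=> c0 cau; rewrite -lerBlDr (le_trans (ler_norm _))// -sqrtr_sqr.
by apply: ler_wsqrtr; nra.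
Qed.

(** [a], [b], [c] may vanish: [bdist] is [0] when the boundary is empty, because
    [inf set0 = 0], and the quotients then involve [0 / 0 = 0]. *)
Lemma point_pair_ineq (R : rcfType) (a b c u v t : R) :
  0 <= a -> 0 <= b -> 0 <= c -> 0 <= u -> 0 <= v -> 0 <= t ->
  t <= u + v -> c <= a + u -> c <= b + v ->
  t / Num.sqrt (t ^+ 2 + 4 * a * b) <=
  Num.sqrt 5 / 2 * (u / Num.sqrt (u ^+ 2 + 4 * a * c) +
                    v / Num.sqrt (v ^+ 2 + 4 * c * b)).
Proof.
move=> a0 b0 c0 u0 v0 t0 tuv cau cbv.
rewrite [4 * c * b]mulrAC.
have Sc := @double_le_addr_sqrt _ _ _ _ c0 cau.
have Wc := @double_le_addr_sqrt _ _ _ _ c0 cbv.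
have sqrtE (e f : R) : 0 <= e -> 0 <= f ->
    Num.sqrt (e ^+ 2 + 4 * f) ^+ 2 = e ^+ 2 + 4 * f.
  by move=> e0 f0; rewrite sqr_sqrtr// addr_ge0 ?sqr_ge0 ?mulr_ge0.
have SE : Num.sqrt (u ^+ 2 + 4 * a * c) ^+ 2 = u ^+ 2 + 4 * (a * c).
  by rewrite -mulrA sqrtE// mulr_ge0.
have WE : Num.sqrt (v ^+ 2 + 4 * b * c) ^+ 2 = v ^+ 2 + 4 * (b * c).
  by rewrite -mulrA sqrtE// mulr_ge0.
have EE : Num.sqrt (t ^+ 2 + 4 * a * b) ^+ 2 = t ^+ 2 + 4 * (a * b).
  by rewrite -mulrA sqrtE// mulr_ge0.
move: Sc Wc SE WE EE (sqrtr_ge0 (u ^+ 2 + 4 * a * c))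
  (sqrtr_ge0 (v ^+ 2 + 4 * b * c)) (sqrtr_ge0 (t ^+ 2 + 4 * a * b)).
move: (Num.sqrt (_ + 4 * a * c)) (Num.sqrt (_ + 4 * b * c))
  (Num.sqrt (_ + 4 * a * b)) => S W E Sc Wc SE WE EE S0 W0 E0.
(* This survives [r = 0], as [e] then vanishes too. *)
have mulVK (e f r : R) : r ^+ 2 = e ^+ 2 + 4 * f -> 0 <= f -> e = e / r * r.
  have [->|r_neq0 _ _] := eqVneq r 0; last by rewrite divfK.
  rewrite mulr0 => + f0; rewrite expr0n /= => /esym/eqP.
  rewrite paddr_eq0 ?sqr_ge0 ?mulr_ge0//.
  by rewrite sqrf_eq0 => /andP[/eqP].
have uE := mulVK _ _ _ SE (mulr_ge0 a0 c0).
have vE := mulVK _ _ _ WE (mulr_ge0 b0 c0).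
have tE := mulVK _ _ _ EE (mulr_ge0 a0 b0).
have : 0 <= u / S by rewrite divr_ge0.
have : 0 <= v / W by rewrite divr_ge0.
move: (u / S) (v / W) uE vE => p q uE vE q0 p0.
have [->|t_neq0] := eqVneq t 0.
  by rewrite mul0r mulr_ge0 ?addr_ge0// divr_ge0// sqrtr_ge0.
have t_gt0 : 0 < t by rewrite lt_neqAle eq_sym t_neq0.
have spos : 0 < p + q.
  rewrite lt_neqAle addr_ge0// andbT eq_sym paddr_eq0//.
  apply/negP => /andP[/eqP p00 /eqP q00].
  by move: tuv; rewrite uE vE p00 q00 !mul0r addr0 leNgt t_gt0.
have E_gt0 : 0 < E.
  rewrite lt_neqAle E0 andbT; apply/eqP => E00.
  by move: t_neq0; rewrite tE -E00 mulr0 eqxx.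
have acE : 4 * (a * c) = S ^+ 2 * (1 - p ^+ 2).
  by apply: (addrI (u ^+ 2)); rewrite -SE uE; ring.
have bcE : 4 * (b * c) = W ^+ 2 * (1 - q ^+ 2).
  by apply: (addrI (v ^+ 2)); rewrite -WE vE; ring.
set M := p + q + 2 * p * q; set D := (1 - p ^+ 2) * (1 - q ^+ 2).
have M_gt0 : 0 < M by rewrite /M ltr_wpDr// !mulr_ge0.
have ct : 2 * c * t <= S * W * M.
  (* The bounds on [2 * c] are paired crosswise: the one from [u] is weighted by [v], and
     conversely. *)
  have -> : S * W * M = (S + u) * v + (W + v) * u by rewrite uE vE /M; ring.
  rewrite (@le_trans _ _ (2 * c * v + 2 * c * u))//.
    by rewrite -mulrDr ler_wpM2l ?mulr_ge0// addrC.
  by rewrite lerD// ler_wpM2r.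
have abM : 0 <= 4 * (a * b) * M ^+ 2.
  by rewrite mulr_ge0 ?sqr_ge0// !mulr_ge0.
have tD : t ^+ 2 * D <= 4 * (a * b) * M ^+ 2.
  (* The main argument cancels [4 * c ^+ 2]. If [c = 0], then [D = 0], since otherwise [S = W = 0],
     so [u = v = 0], against [t > 0]. *)
  have [c00|c_neq0] := eqVneq c 0.
    have : D = 0.
      move/eqP: bcE; rewrite c00 !mulr0 eq_sym mulf_eq0 sqrf_eq0.
      case/orP => [/eqP W00|/eqP q1]; last by rewrite /D q1 mulr0.
      move/eqP: acE; rewrite c00 !mulr0 eq_sym mulf_eq0 sqrf_eq0.
      case/orP => [/eqP S00|/eqP p1]; last by rewrite /D p1 mul0r.
      by move: tuv; rewrite uE vE S00 W00 !mulr0 addr0 leNgt t_gt0.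
    by move=> ->; rewrite mulr0.
  have c_gt0 : 0 < c by rewrite lt_neqAle eq_sym c_neq0.
  have [Dn|Dp] := ltP D 0.
    by rewrite (le_trans _ abM)// mulr_ge0_le0 ?sqr_ge0// ltW.
  rewrite -(@ler_pM2l _ (4 * c ^+ 2)) ?mulr_gt0 ?exprn_gt0//.
  have -> : 4 * c ^+ 2 * (t ^+ 2 * D) = (2 * c * t) ^+ 2 * D by ring.
  have -> : 4 * c ^+ 2 * (4 * (a * b) * M ^+ 2) =
      (4 * (a * c)) * (4 * (b * c)) * M ^+ 2 by ring.
  have -> : (4 * (a * c)) * (4 * (b * c)) * M ^+ 2 = (S * W * M) ^+ 2 * D.
    by rewrite acE bcE /D; ring.
  rewrite ler_wpM2r// lerXn2r ?nnegrE ?mulr_ge0//; exact: ltW.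
have H := @pair_sum_ineq _ _ _ p0 q0; rewrite -/M -/D in H.
(* The sign of [D] is not known here; positivity is read off from [H], whose left side is
   positive. *)
have MD_gt0 : 0 < M ^+ 2 + D.
  have Q0 : 0 < 5 * (p + q) ^+ 2 by rewrite mulr_gt0// exprn_gt0.
  rewrite -(pmulr_rgt0 _ Q0) (lt_le_trans _ H)//.
  by rewrite mulr_gt0// exprn_gt0.
rewrite ler_pdivrMr//.
rewrite -(@ler_pXn2r _ 2) ?nnegrE//; last first.
  by rewrite !mulr_ge0 ?addr_ge0 ?sqrtr_ge0 ?invr_ge0// ltW.
rewrite !exprMn sqr_sqrtr// exprVn EE.
(* With [s = p + q], the chain is [4t^2(M^2 + D) <= 4M^2(t^2 + 4ab) <= 5s^2(M^2 + D)(t^2 + 4ab)], by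
   [tD] and then [H]. *)
rewrite -(ler_pM2r MD_gt0).
have e0 : 0 <= t ^+ 2 + 4 * (a * b) by rewrite -EE sqr_ge0.
have := ler_wpM2r e0 H.
move: tD; nra.
Qed.

Section Euclidean.
Context {R : realType} {n : nat}.
Implicit Types (x y z : 'rV[R]_n) (G : set 'rV[R]_n).

Lemma enorm_ge0 x : 0 <= enorm x.
Proof. exact: sqrtr_ge0. Qed.

Lemma sqr_enorm x : enorm x ^+ 2 = \sum_(i < n) x ord0 i ^+ 2.
Proof. by rewrite sqr_sqrtr// sumr_ge0// => i _; rewrite sqr_ge0. Qed.

Lemma enorm_eq0 x : enorm x = 0 -> x = 0.
Proof.
move=> x0; apply/rowP => i; rewrite mxE; apply/eqP; rewrite -sqrf_eq0.
have /eqP := sqr_enorm x; rewrite x0 expr0n /= eq_sym.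
rewrite psumr_eq0 => [/allP/(_ i)|j _]; last exact: sqr_ge0.
by rewrite mem_index_enum => /(_ isT).
Qed.

Lemma enorm0 : enorm (0 : 'rV[R]_n) = 0.
Proof.
by rewrite /enorm big1 ?sqrtr0// => i _; rewrite mxE expr0n.
Qed.

Lemma enormN x : enorm (- x) = enorm x.
Proof. by congr Num.sqrt; apply: eq_bigr => i _; rewrite mxE sqrrN. Qed.

Lemma enormB x y : enorm (x - y) = enorm (y - x).
Proof. by rewrite -enormN opprB. Qed.

Lemma cauchy_schwarz x y :
  \sum_(i < n) x ord0 i * y ord0 i <= enorm x * enorm y.
Proof.
have [x0|x_neq0] := eqVneq (enorm x) 0.
  rewrite x0 mul0r (enorm_eq0 _ x0) big1// => i _; by rewrite mxE mul0r.
have [y0|y_neq0] := eqVneq (enorm y) 0.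
  rewrite y0 mulr0 (enorm_eq0 _ y0) big1// => i _; by rewrite mxE mulr0.
have A0 : 0 < enorm x by rewrite lt_neqAle eq_sym x_neq0 enorm_ge0.
have B0 : 0 < enorm y by rewrite lt_neqAle eq_sym y_neq0 enorm_ge0.
(* Expanded, this sum is [2|x||y|(|x||y| - w)], with [w] the inner product. *)
have : 0 <= \sum_(i < n) (enorm y * x ord0 i - enorm x * y ord0 i) ^+ 2.
  by apply: sumr_ge0 => i _; exact: sqr_ge0.
rewrite (eq_bigr (fun i => enorm y ^+ 2 * x ord0 i ^+ 2 +
    enorm x ^+ 2 * y ord0 i ^+ 2 -
    2 * (enorm x * enorm y) * (x ord0 i * y ord0 i))) => [|i _]; last by ring.
rewrite sumrB big_split /= -!mulr_sumr -!sqr_enorm.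
set w := \sum_(i < n) _ => h.
rewrite -(ler_pM2l (mulr_gt0 A0 B0)); nra.
Qed.

Lemma ler_enormD x y : enorm (x + y) <= enorm x + enorm y.
Proof.
rewrite -(@ler_pXn2r _ 2) ?nnegrE ?addr_ge0 ?enorm_ge0//.
rewrite sqr_enorm sqrrD !sqr_enorm.
under eq_bigr => i _ do rewrite mxE sqrrD.
rewrite 2!big_split /= lerD2r lerD2l sumrMnl lerMn2r.
exact: cauchy_schwarz.
Qed.

Lemma ler_enorm_distD z x y : enorm (x - y) <= enorm (x - z) + enorm (z - y).
Proof. by rewrite (le_trans _ (ler_enormD _ _))// addrA subrK. Qed.

Lemma bdist_ge0 G x : 0 <= bdist G x.
Proof.
rewrite /bdist.
have [->|/set0P E0] := eqVneq [set enorm (x - z) | z in boundary G] set0.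
  by rewrite inf0.
by apply: lb_le_inf => // _ [z _ <-]; exact: enorm_ge0.
Qed.

(** Take the infimum over boundary points [z] in [|x - z| <= |x - y| + |y - z|]. *)
Lemma bdist_lip G x y : bdist G x <= bdist G y + enorm (x - y).
Proof.
rewrite /bdist; have [->|/set0P[w Gw]] := eqVneq (boundary G) set0.
  by rewrite !image_set0 inf0 add0r enorm_ge0.
rewrite -lerBlDr; apply: lb_le_inf; first by exists (enorm (y - w)), w.
move=> _ [z Gz <-]; rewrite lerBlDr addrC.
apply: le_trans (ler_enorm_distD y x z); apply: ge_inf; last by exists z.
by exists 0 => _ [? _ <-]; exact: enorm_ge0.
Qed.

End Euclidean.

Theorem theorem4p14 (R : realType) (n : nat) (n_ge1 : (1 <= n)%N)
    (G : set 'rV[R]_n) (domG : domain G) (properG : G `<` [set: 'rV[R]_n]) :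
  exists2 c : R, c <= Num.sqrt 5 / 2 & quasi_metric G c (point_pair G).
Proof.
exists (Num.sqrt 5 / 2) => //; split.
- rewrite ler_pdivlMr// mul1r -(@ler_pXn2r _ 2) ?nnegrE ?sqrtr_ge0//.
  by rewrite sqr_sqrtr//; lra.
- move=> x y _ _; split; first by rewrite divr_ge0 ?enorm_ge0 ?sqrtr_ge0.
  split=> [/eqP|->]; last by rewrite /point_pair subrr enorm0 mul0r.
  rewrite /point_pair mulf_eq0 invr_eq0 => xy0.
  apply: subr0_eq; apply: enorm_eq0; case/orP: xy0 => [/eqP//|].
  (* The quotient also vanishes when its denominator is [0]; the nonnegative terms under the root
     then force [|x - y| = 0]. *)
  rewrite sqrtr_eq0 => sum_le0.
  have d0 : 0 <= 4 * bdist G x * bdist G y by rewrite !mulr_ge0 ?bdist_ge0.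
  apply/eqP; rewrite -sqrf_eq0 eq_le sqr_ge0 andbT.
  by rewrite (le_trans _ sum_le0)// lerDl.
- by move=> x y _ _; rewrite /point_pair enormB mulrAC.
move=> x y z _ _ _; apply: point_pair_ineq;
  rewrite ?bdist_ge0 ?enorm_ge0 ?ler_enorm_distD ?bdist_lip//.
by rewrite enormB bdist_lip.
Qed.
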